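(* Let $X$ be a real-valued random variable and let $p \in [0,1]$. Then $$lq_X(p) = -\,rq_{-X}(1-p).$$
   Context: For a real-valued random variable $Y$ with distribution function $F_Y(x)=P(Y\le x)$, $x\in\mathbb{R}$, the left quantile function is $lq_Y(p)=\inf\{x\in\mathbb{R} : F_Y(x)\ge p\}$ and the right quantile function is $rq_Y(p)=\inf\{x\in\mathbb{R} : F_Y(x)>p\}=\sup\{x\in\mathbb{R} : F_Y(x)\le p\}$, for $p\in[0,1]$. Infima and suprema are taken in the extended real line $[-\infty,\infty]$, with $\inf\emptyset=+\infty$, $\sup\emptyset=-\infty$, and $-(\pm\infty)=\mp\infty$. *)

(* Defs.v *)
From HB Require Import structures.
From mathcomp Require Import all_boot all_order all_algebra.
From mathcomp Require Import all_classical all_reals all_analysis.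

Set Implicit Arguments.
Unset Strict Implicit.
Unset Printing Implicit Defensive.

Import Order.TTheory GRing.Theory Num.Theory.

Local Open Scope classical_set_scope.
Local Open Scope ereal_scope.

Section quantiles.
Context d (T : measurableType d) (R : realType) (P : probability T R).
Implicit Types (Y : {RV P >-> R}) (p : R).

Definition left_quantile Y p : \bar R :=
  ereal_inf [set x%:E | x in [set x : R | p%:E <= cdf Y x]].

Definition right_quantile Y p : \bar R :=
  ereal_inf [set x%:E | x in [set x : R | p%:E < cdf Y x]].

Lemma right_quantile_sup Y p :
  right_quantile Y p =
  ereal_sup [set x%:E | x in [set x : R | cdf Y x <= p%:E]].
Proof.
apply/eqP; rewrite eq_le; apply/andP; split; last first.
  apply: ge_ereal_sup => _ [x /= xp <-].
  apply: le_ereal_inf_tmp => _ [y /= py <-].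
  rewrite lee_fin leNgt; apply/negP => /ltW yx.
  by have := lt_le_trans py (le_trans (cdf_nondecreasing Y yx) xp); rewrite ltxx.
set s := ereal_sup _.
have si r : s < r%:E -> right_quantile Y p <= r%:E.
  move=> sr; apply: ereal_inf_lbound; exists r => //=.
  rewrite ltNge; apply/negP => rp; move: sr; rewrite ltNge => /negP; apply.
  by apply: ereal_sup_ubound; exists r.
case: s si => [r| |] si; last 2 first.
- exact: leey.
- case: (right_quantile Y p) si => [i| |] si //; last first.
    by have := si 0%R (ltNyr _); rewrite leye_eq.
  by have := si (i - 1)%R (ltNyr _); rewrite lee_fin lerBrDl gerDr ler10.
- by apply/lee_addgt0Pr => e e0; rewrite -EFinD si// lte_fin ltrDl.
Qed.

End quantiles.

Arguments left_quantile {d T R} P Y p.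
Arguments right_quantile {d T R} P Y p.

(* Main.v *)
Require Import Defs.
From HB Require Import structures.
From mathcomp Require Import all_boot all_order all_algebra.
From mathcomp Require Import all_classical all_reals all_analysis.
From mathcomp Require Import measurable_realfun.

(** The substitution [x = - y] turns [- rq_{-X}(1 - p)] into a supremum:
    since [P(-X <= y) = 1 - P(X < - y)], the condition [P(-X <= y) > 1 - p]
    reads [P(X < x) < p] ([cdf_opp_gt]), so that
    [- rq_{-X}(1 - p) = sup {x | P(X < x) < p}].

    It remains to compare this with [lq_X(p) = inf {x | P(X <= x) >= p}].
    The two sets form a cut of the real line.  A point [x] of the first never
    exceeds a point [y] of the second, as [y < x] would give
    [P(X <= y) <= P(X < x)].  Together they cover the line, because
    [P(X < x) <= P(X <= x)].  The supremum of the lower part of a cut is the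
    infimum of the upper part ([ereal_sup_inf_cut]).  An atom
    of [X] may make the two parts overlap, but only in their common boundary
    point. *)

Import Order.TTheory GRing.Theory Num.Theory.
Local Open Scope classical_set_scope.
Local Open Scope ereal_scope.

(** The parts may share a boundary point, and either may be empty; an empty
    lower part makes both sides [-oo], an empty upper part makes them [+oo]. *)
Lemma ereal_sup_inf_cut (R : realType) (A B : set R) :
  (forall a b, A a -> B b -> (a <= b)%R) -> (forall x, A x \/ B x) ->
  ereal_sup (EFin @` A) = ereal_inf (EFin @` B).
Proof.
move=> AB cover; apply/eqP; rewrite eq_le; apply/andP; split.
  apply: ge_ereal_sup => _ [a Aa <-].
  by apply: le_ereal_inf_tmp => _ [b Bb <-]; rewrite lee_fin AB.
set s := ereal_sup _.
(* A real strictly above [s] lies outside [A], hence in [B]. *)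
have inf_le r : s < r%:E -> ereal_inf (EFin @` B) <= r%:E.
  move=> sr; apply: ereal_inf_lbound; exists r => //.
  case: (cover r) => // Ar; move: sr; rewrite ltNge => /negP[].
  by apply: ereal_sup_ubound; exists r.
case: s inf_le => [r| |] inf_le.
- by apply/lee_addgt0Pr => e e0; rewrite -EFinD inf_le// lte_fin ltrDl.
- exact: leey.
- case: (ereal_inf _) inf_le => [i| |] inf_le //.
  + by have := inf_le (i - 1)%R (ltNyr _); rewrite lee_fin lerBrDl gerDr ler10.
  + by have := inf_le 0%R (ltNyr _); rewrite leye_eq.
Qed.

Section quantile_opp.
Context (d : measure_display) (T : measurableType d) (R : realType).
Context (P : probability T R) (X : {RV P >-> R}).

(** The events [-X <= - x] and [X < x] are complementary.  The second is open
    at [x], which is why [distribution] on an open ray appears here and not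
    [cdf X x]. *)
Lemma cdf_opp_gt (p x : R) :
  ((1 - p)%:E < cdf (- X : {RV P >-> R})%R (- x)%R) =
  (distribution P X `]-oo, x[%classic < p%:E).
Proof.
have -> : cdf (- X : {RV P >-> R})%R (- x)%R =
    1 - distribution P X `]-oo, x[%classic.
  rewrite -probability_setC// setCitvl /cdf /distribution /pushforward.
  by congr (P _); apply/seteqP; split=> t /=; rewrite !in_itv/= andbT lerN2.
(* Probabilities are finite, so the inequality can be read in [R], where [1]
   cancels. *)
rewrite -(fineK (fin_num_measure (distribution P X) `]-oo, x[%classic _))//.
by rewrite -EFinB !lte_fin ltrD2l ltrN2.
Qed.

Lemma opp_right_quantile_opp (p : R) :
  - right_quantile P (- X)%R (1 - p)%R =
  ereal_sup (EFin @` [set x | distribution P X `]-oo, x[%classic < p%:E]).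
Proof.
rewrite /right_quantile /ereal_inf oppeK; congr ereal_sup.
apply/seteqP; split=> [_ [_ [y py <-] <-]|_ [x px <-]].
  by exists (- y)%R => //=; rewrite -cdf_opp_gt opprK.
exists (- x)%:E; last by rewrite /= opprK.
by exists (- x)%R => //=; rewrite cdf_opp_gt.
Qed.

(** Both properties of the cut come from an inclusion of rays: a closed ray
    lies in every open ray with a larger endpoint, and the open ray at a point
    lies in the closed one. *)
Lemma left_quantile_sup (p : R) :
  left_quantile P X p =
  ereal_sup (EFin @` [set x | distribution P X `]-oo, x[%classic < p%:E]).
Proof.
apply/esym/ereal_sup_inf_cut => [x y /= xp py|x /=].
  rewrite leNgt; apply/negP => yx.
  move: (lt_le_trans xp py); rewrite ltNge => /negP[].
  rewrite /cdf; apply: le_measure; rewrite ?inE//.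
  by move=> z /=; rewrite !in_itv/= => /le_lt_trans; apply.
case: (ltP (distribution P X `]-oo, x[%classic) p%:E) => [|px]; first by left.
right; apply: (le_trans px); rewrite /cdf; apply: le_measure; rewrite ?inE//.
by move=> z /=; rewrite !in_itv/=; exact: ltW.
Qed.

End quantile_opp.

Theorem theorem3p1 (d : measure_display) (T : measurableType d) (R : realType)
    (P : probability T R) (X : {RV P >-> R}) (p : R)
    (p01 : (0 <= p <= 1)%R) :
  left_quantile P X p = - right_quantile P (- X)%R (1 - p)%R.
Proof. by rewrite left_quantile_sup opp_right_quantile_opp. Qed.
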